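(* Let $x$ be a homogeneously adequate state of a connected link diagram $D\subset S^2$. For any point $p$ on a state circle of $x$, away from crossing arcs, $x$ has enhancements $X^-$ and $X^+$ such that: $X^-$ assigns label $1$ and $X^+$ assigns label $0$ to the state circle containing $p$; $X^-$ and $X^+$ are identical away from $p$ (they assign the same label to every other state circle of $x$); and both $\operatorname{tr}_{\mathbb{F}_2}X^+$ and $\operatorname{tr}_{\mathbb{F}_2}X^-$ represent nonzero Khovanov homology classes, i.e. they are cycles in $\mathcal{C}_{\mathbb{F}_2}(D)$ that are not exact. If in addition the graph $G_{x_A}$ is bipartite, then both $\operatorname{tr}_{\mathbb{Z}}X^+$ and $\operatorname{tr}_{\mathbb{Z}}X^-$ represent nonzero homology classes of $\mathcal{C}_{\mathbb{Z}}(D)$.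
   Context: States. Let $D\subset S^2$ be a connected link diagram with crossings $c^1,\dots,c^n$. A (Kauffman) state $x$ of $D$ is obtained by choosing at each crossing the $A$-smoothing or the $B$-smoothing (standard Kauffman convention); it consists of disjoint circles in $S^2$ (state circles) together with one crossing arc for each crossing, labeled $A$ or $B$ according to the smoothing, joining the two strands of the smoothed crossing. An enhancement $X$ of $x$ (an enhanced state) assigns a label $0$ or $1$ to each state circle. Chain complex. For a ring $R$ with $1$, $\mathcal{C}_R(x)$ is the free $R$-module on the enhancements of $x$, and $\mathcal{C}_R(D)=\bigoplus_x\mathcal{C}_R(x)$ over all states $x$ of $D$. For an enhancement $X$ of $x$ and a crossing $c$: if $x$ has the $B$-smoothing at $c$, then $d_cX=0$. If $x$ has the $A$-smoothing at $c$, $d_cX$ is supported on the state obtained by changing the smoothing at $c$ to $B$, with all labels on circles not incident to the arc at $c$ unchanged, and: if the arc at $c$ joins two distinct circles, these merge, with labels $(1,1)\mapsto 0$ (the zero chain), $(0,1),(1,0)\mapsto$ one circle labeled $1$, $(0,0)\mapsto$ one circle labeled $0$; if the arc at $c$ joins a circle to itself, that circle splits in two, with label $1\mapsto$ labels $(1,1)$, and label $0\mapsto$ the sum of the enhanced states with labels $(1,0)$ and $(0,1)$. Then $dX=\sum_t(-1)^{a_t(X)}d_{c^t}X$, where $a_t(X)$ is the number of $s<t$ such that $x$ has an $A$-smoothing at $c^s$; extend $R$-linearly. One has $d\circ d=0$; cycles are elements of $\ker d$, exact chains are elements of $\operatorname{im} d$, and Khovanov homology is $\ker d/\operatorname{im}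 d$. Homogeneous adequacy. $G_x$ is the graph obtained from $x$ by collapsing each state circle to a vertex, with the crossing arcs as ($A$- or $B$-labeled) edges. Cut $G_x$ simultaneously along all its cut vertices (vertices whose deletion disconnects $G_x$); the subsets of $x$ corresponding to the resulting connected components are the blocks of $x$. The state $x$ is homogeneous if no block contains both $A$- and $B$-type crossing arcs, adequate if each crossing arc joins two distinct state circles, and homogeneously adequate if both. $x_A$ is the union of all $A$-type crossing arcs and the state circles incident to them; $G_{x_A}$ is the graph obtained from $x_A$ by collapsing each state circle to a vertex; the $A$-zones of $x$ are the connected components of $x_A$, and an $A$-zone is bipartite if the corresponding component of $G_{x_A}$ is. $A$-traces. $\sim_A$ is the equivalence relation on enhanced states generated by the moves that, for some $A$-type crossing arc joining two state circles with different labels, exchange these two labels ($0,1\leftrightarrow 1,0$), leaving everything else unchanged. For an enhanced state $X$, $\operatorname{tr}_{\mathbb{F}_2}X=\sum_{Y\sim_A X}Y$. If every non-bipartite $A$-zone is labeled entirely by $1$ in $X$, then for $Y\sim_A X$ let $\operatorname{sgn}(X\to Y)=\pm1$ according to whether an even or odd number of such moves takes $X$ to $Y$ (well defined), and $\operatorname{tr}_{\mathbb{Z}}X=\sum_{Y\sim_A X}\operatorname{sgn}(X\to Y)\,Y$. *)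

(* Defs.v *)
From HB Require Import structures.
From mathcomp Require Import all_boot all_order all_algebra.

Set Implicit Arguments.
Unset Strict Implicit.
Unset Printing Implicit Defensive.

Import Order.TTheory GRing.Theory Num.Theory.
Local Open Scope ring_scope.

(** * Connected link diagrams on the sphere

  A diagram is encoded as a planar-diagram (PD) code.  The four ends at a
  crossing are numbered 0, 1, 2, 3 counterclockwise, ends 0 and 2 being those
  of the under-strand.  [inc (c, i)] is the edge of the diagram (a component
  of the diagram minus its crossings) leaving the crossing [c] at its end [i].
  An edge has two ends, unless it is a crossingless circle, which has none. *)

Section PDCode.
Variables (n : nat) (E : finType) (inc : 'I_n * 'I_4 -> E).

Definition pd_wf : Prop :=
  forall a : E, #|[set h | inc h == a]| = 2%N \/ #|[set h | inc h == a]| = 0%N.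

(* The other end of the edge which leaves from the end [h]. *)
Definition pd_mate (h : 'I_n * 'I_4) : 'I_n * 'I_4 :=
  odflt h [pick k | (k != h) && (inc k == inc h)].

(* Two edges meet at a crossing. *)
Definition pd_meet (a b : E) : bool :=
  [exists c, exists i, exists j, (inc (c, i) == a) && (inc (c, j) == b)].

Definition pd_connected : Prop :=
  (0 < #|E|)%N /\ forall a b : E, connect pd_meet a b.

(* Follow an edge to its other end, then turn to the next end around the
   crossing reached: the orbits are the boundaries of the complementary
   regions of the diagram. *)
Definition pd_face (h : 'I_n * 'I_4) : 'I_n * 'I_4 :=
  ((pd_mate h).1, ordS (pd_mate h).2).

(* Euler's formula V - E + F = 2 for a connected diagram, with V = n and
   E = 2 n.  For n = 0 a connected diagram is one crossingless circle, for
   which there is nothing to require. *)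
Definition pd_spherical : Prop :=
  (0 < n)%N -> fcard pd_face predT = n.+2.

End PDCode.

Record link_diagram := LinkDiagram {
  ncross : nat;
  edge : finType;
  edge_at : 'I_ncross * 'I_4 -> edge;
  edge_at_wf : pd_wf edge_at;
  edge_at_connected : pd_connected edge_at;
  edge_at_spherical : pd_spherical edge_at }.

(** * States *)

Section States.
Variable D : link_diagram.

Local Notation crossing := 'I_(ncross D).

(* [true] is the A-smoothing and [false] the B-smoothing. *)
Definition state : Type := {ffun crossing -> bool}.

(* The end to which the smoothing of type [s] connects the end [i] of a
   crossing.  The regions swept by the over-strand (ends 1 and 3) when it turns
   counterclockwise are those between ends 1, 2 and between ends 3, 0; the
   A-smoothing merges them, so it connects 0 with 1 and 2 with 3.  The
   B-smoothing connects 1 with 2 and 3 with 0. *)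
Definition smooth (s : bool) (i : 'I_4) : 'I_4 :=
  if s == odd i then ord_pred i else ordS i.

Definition smooth_rel (x : state) (a b : edge D) : bool :=
  [exists c : crossing, exists i : 'I_4,
     (edge_at (c, i) == a) && (edge_at (c, smooth (x c) i) == b)].

(* A state circle is identified with the set of edges that it contains;
   [circle x a] is the one through the edge [a].  ([smooth_rel] is
   symmetric, hence [connect] is an equivalence relation.) *)
Definition circle (x : state) (a : edge D) : {set edge D} :=
  [set b | connect (smooth_rel x) a b].

Definition circles (x : state) : {set {set edge D}} :=
  [set circle x a | a : edge D].

(* The ends 0 and 2 of a crossing lie on different strands for both smoothings:
   they give the two strands joined by the crossing arc. *)
Definition end0 (c : crossing) : edge D := edge_at (c, @Ordinal 4 0 isT).
Definition end2 (c : crossing) : edge D := edge_at (c, @Ordinal 4 2 isT).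

(* The endpoints, in the graph G_x, of the edge given by the crossing [c]. *)
Definition arc_ends (x : state) (c : crossing) : {set {set edge D}} :=
  [set circle x (end0 c); circle x (end2 c)].

Definition adequate (x : state) : Prop :=
  forall c : crossing, circle x (end0 c) <> circle x (end2 c).

(* Adjacency in the graph obtained from G_x by deleting the vertex [v]. *)
Definition del_adj (x : state) (v u w : {set edge D}) : bool :=
  [&& u != v, w != v &
      [exists c : crossing, (u \in arc_ends x c) && (w \in arc_ends x c)]].

Definition cut_vertex (x : state) (v : {set edge D}) : bool :=
  [exists u in circles x :\ v, exists w in circles x :\ v,
     ~~ connect (del_adj x v) u w].

(* Cutting G_x along a cut vertex [v] replaces [v] by one copy for each component
   of G_x - v, to which the edges from [v] to this component get attached.  Thus
   the edges [c] and [c'] of the cut graph share a vertex coming from [v] iff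
   they are both incident to [v] and, if [v] is a cut vertex, lead from [v] to
   the same component of G_x - v. *)
Definition attached (x : state) (c c' : crossing) : bool :=
  [exists v in circles x,
     [&& v \in arc_ends x c, v \in arc_ends x c' &
         cut_vertex x v ==>
         [exists u in arc_ends x c :\ v, exists w in arc_ends x c' :\ v,
            connect (del_adj x v) u w]]].

Definition same_block (x : state) : rel crossing := connect (attached x).

Definition homogeneous (x : state) : Prop :=
  forall c c' : crossing, same_block x c c' -> x c = x c'.

Definition homogeneously_adequate (x : state) : Prop :=
  homogeneous x /\ adequate x.

(* Bipartiteness of G_{x_A}; the values of the colouring on the circles not
   incident to an A-type arc, which are not vertices of this graph, are
   irrelevant. *)
Definition GxA_bipartite (x : state) : Prop :=
  exists f : {set edge D} -> bool,
    forall c : crossing, x c -> f (circle x (end0 c)) != f (circle x (end2 c)).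

(** * Enhanced states *)

(* The labels 0 and 1 are [false] and [true].  A labelling of the state circles
   is given as a function on edges which is constant on each state circle. *)
Definition labelling_of (X : state * {ffun edge D -> bool}) : bool :=
  [forall a, forall b, (circle X.1 a == circle X.1 b) ==> (X.2 a == X.2 b)].

Definition enhanced : Type :=
  {X : state * {ffun edge D -> bool} | labelling_of X}.

Definition state_of (X : enhanced) : state := (val X).1.

(* The label of the state circle through the edge [a]. *)
Definition label (X : enhanced) (a : edge D) : bool := (val X).2 a.

(** * Khovanov chain complex *)

(* [d_term c X Y]: the enhanced state [Y] occurs in [d_c X]; all the coefficients
   of [d_c X] are 0 or 1. *)
Definition d_term (c : crossing) (X Y : enhanced) : bool :=
  let x := state_of X in
  let C0 := circle x (end0 c) in
  let C2 := circle x (end2 c) in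
  [&& x c,
      state_of Y == [ffun t => if t == c then false else x t],
      [forall a, (a \notin C0 :|: C2) ==> (label Y a == label X a)]
    & if C0 != C2 then
        (* merging: (1,1) -> none, (0,1), (1,0) -> 1, (0,0) -> 0 *)
        ~~ (label X (end0 c) && label X (end2 c)) &&
        (label Y (end0 c) == (label X (end0 c) || label X (end2 c)))
      else if label X (end0 c) then
        (* splitting: 1 -> (1,1) *)
        label Y (end0 c) && label Y (end2 c)
      else
        (* splitting: 0 -> (1,0) + (0,1) *)
        label Y (end0 c) != label Y (end2 c)].

Definition nA_before (t : crossing) (X : enhanced) : nat :=
  #|[set s : crossing | (s < t)%N && state_of X s]|.

Definition chain (R : pzRingType) : Type := {ffun enhanced -> R}.

(* An enhanced state seen as a basis element of the chain module. *)
Definition gen (R : pzRingType) (X : enhanced) : {ffun enhanced -> R} :=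
  [ffun Y => (Y == X)%:R].

Definition diff (R : pzRingType) (u : chain R) : chain R :=
  [ffun Y => \sum_(X : enhanced) \sum_(t : crossing)
               u X * ((-1) ^+ nA_before t X * (d_term t X Y)%:R)].

Definition cycle_chain (R : pzRingType) (u : chain R) : Prop :=
  diff u = 0 :> {ffun enhanced -> R}.

Definition exact_chain (R : pzRingType) (u : chain R) : Prop :=
  exists v : chain R, u = diff v.

Definition nonzero_class (R : pzRingType) (u : chain R) : Prop :=
  cycle_chain u /\ ~ exact_chain u.

(** * A-traces *)

(* [Y] is obtained from [X] by exchanging the different labels of the two circles
   joined by some A-type arc.  This relation is symmetric, so that [connect A_move]
   is the equivalence relation that it generates. *)
Definition A_move (X Y : enhanced) : bool :=
  let x := state_of X in
  (state_of Y == x) &&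
  [exists c : crossing,
     [&& x c, label X (end0 c) != label X (end2 c) &
         [forall a, label Y a ==
            (if a \in circle x (end0 c) then label X (end2 c)
             else if a \in circle x (end2 c) then label X (end0 c)
             else label X a)]]].

Definition A_equiv : rel enhanced := connect A_move.

Definition A_move_parity (Xb Yb : enhanced * bool) : bool :=
  A_move Xb.1 Yb.1 && (Yb.2 == ~~ Xb.2).

(* 1 if an even number of moves takes [X] to [Y], and -1 otherwise.  For
   [A_equiv X Y] the parity of the number of moves depends only on [X] and [Y]
   as soon as every non-bipartite A-zone is labelled entirely by 1 in [X], in
   particular if G_{x_A} is bipartite; [sgn] and [trZ] are junk values if
   the parity is ambiguous. *)
Definition sgn (X Y : enhanced) : int :=
  if connect A_move_parity (X, false) (Y, false) then 1 else -1.

Definition trF2 (X : enhanced) : chain 'F_2 :=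
  \sum_(Y | A_equiv X Y) gen 'F_2 Y.

Definition trZ (X : enhanced) : chain int :=
  \sum_(Y | A_equiv X Y) gen int Y *~ sgn X Y.

End States.

(* Main.v *)
(** Cycles: if every A-zone of X has at most one label 0, each term of d(tr X) is
  a merging of circles labelled 0 and 1, and exchanging these labels cancels the
  terms in pairs.  Dually, if every B-zone has at most one label 1, the sum of
  the coefficients over all enhancements obtained from X by exchanging labels
  along B-type arcs is a functional over F_2 which vanishes on exact chains.  So
  it suffices that X has both properties and is the only enhancement reached
  from X both by A-moves and by B-moves: the functional is then 1 on tr X.
  Exactness over Z implies exactness over F_2.

  To get such an X, label p arbitrarily and any other circle q by the type of the
  zone through which q is joined to p, i.e. the zone of q which contains circles
  closer to p than q.  Homogeneity says that this type is unique: the first arcs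
  of two paths from q to p that do not return to q are attached at q. *)

Require Import Defs.
From mathcomp Require Import all_boot all_order all_algebra.

Set Implicit Arguments.
Unset Strict Implicit.
Unset Printing Implicit Defensive.

Import GRing.Theory.

(** The predicate [b] selects one element of each pair exchanged by [s]. This rules out fixed
    points, whose terms would only satisfy F = - F, which says nothing in characteristic 2. *)
Lemma sum_antisym (T : finType) (V : zmodType) (P b : pred T) (s : T -> T) (F : T -> V) :
  (forall y, P y -> P (s y)) -> (forall y, P y -> s (s y) = y) ->
  (forall y, P y -> b (s y) = ~~ b y) ->
  (forall y, P y -> F (s y) = - F y)%R -> (\sum_(y | P y) F y = 0)%R.
Proof.
move=> sP sK sb sF; rewrite (bigID b) /=.
rewrite [X in (_ + X)%R](reindex_onto s s) /=; last by move=> y /andP[/sK].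
rewrite [X in (_ + X)%R](_ : _ = \sum_(y | P y && b y) - F y)%R; last first.
  apply: eq_big => [y|y /andP[/andP[Py _] /eqP sy]]; last by rewrite sF // -sy sP.
  apply/idP/idP => [/andP[/andP[Py by_] /eqP sy]|/andP[Py by_]].
    have Psy : P y by rewrite -sy sP.
    by rewrite Psy -[b y]negbK -sb.
  by rewrite sP // sb // negbK by_ sK //= eqxx.
by rewrite sumrN subrr.
Qed.

(** * State circles and the change of one smoothing *)

Section Circles.
Variables (D : link_diagram) (x : state D).
Local Notation crossing := 'I_(ncross D).
Implicit Types (c : crossing) (i j : 'I_4) (a b : edge D).

Lemma smoothK s : involutive (smooth s).
Proof. by case: s => -[[|[|[|[|]]]] //= ?]; apply: val_inj. Qed.

Lemma odd_smooth s i : odd (smooth s i) = ~~ odd i.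
Proof. by case: s i => -[[|[|[|[|]]]] //= ?]. Qed.

Lemma smooth_rel_sym : symmetric (smooth_rel x).
Proof.
suff sub a b : smooth_rel x a b -> smooth_rel x b a by move=> a b; apply/idP/idP; apply: sub.
case/existsP => c /existsP[i /andP[ha hb]]; apply/existsP; exists c.
by apply/existsP; exists (smooth (x c) i); rewrite smoothK ha hb.
Qed.

Lemma mem_circle a b : (b \in circle x a) = (circle x a == circle x b).
Proof.
have csym := sym_connect_sym smooth_rel_sym.
rewrite inE; apply/idP/eqP => [ab|E].
  by apply/setP => e; rewrite !inE (same_connect csym ab).
have : b \in circle x b by rewrite inE.
by rewrite -E inE.
Qed.

Lemma circle_smooth c i :
  circle x (edge_at (c, i)) = circle x (edge_at (c, smooth (x c) i)).
Proof.
apply/eqP; rewrite -mem_circle inE connect1 //.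
by apply/existsP; exists c; apply/existsP; exists i; rewrite !eqxx.
Qed.

Definition on_strand0 s i : bool := (i == 0 :> nat) || (smooth s i == 0 :> nat).

Lemma circle_edge_at c i : circle x (edge_at (c, i)) =
  circle x (if on_strand0 (x c) i then end0 c else end2 c).
Proof.
have e0 (j : 'I_4) : j = 0 :> nat -> edge_at (c, j) = end0 c.
  by move=> j0; congr (edge_at (c, _)); apply: val_inj.
have e2 (j : 'I_4) : j = 2 :> nat -> edge_at (c, j) = end2 c.
  by move=> j0; congr (edge_at (c, _)); apply: val_inj.
rewrite /on_strand0; case: eqP => [/e0-> //|/eqP i0] /=.
case: eqP => [/e0 j0|/eqP j0]; first by rewrite circle_smooth j0.
have [/e2 -> //|/eqP i2] := eqVneq (i : nat) 2; rewrite circle_smooth e2 //.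
by move: i0 j0 i2; case: (x c) i => -[[|[|[|[|]]]]].
Qed.

Lemma on_strand0N s i j : j != i -> j != smooth s i -> on_strand0 s j = ~~ on_strand0 s i.
Proof. by case: s i j => -[[|[|[|[|]]]]] // ? [[|[|[|[|]]]]]. Qed.

Lemma circle_arc_end c i : circle x (edge_at (c, i)) \in arc_ends x c.
Proof. by rewrite circle_edge_at !inE; case: ifP; rewrite eqxx ?orbT. Qed.

(** By well-formedness each edge of [T] contributes two ends or none. *)
Lemma even_ends (T : {set edge D}) : ~~ odd #|[set h | edge_at h \in T]|.
Proof.
rewrite -sum1_card (partition_big (@edge_at D) (mem T)) /=; last by move=> h; rewrite inE.
apply: (big_ind (fun k => ~~ odd k)) => // [k l /negPf hk /negPf hl|a aT].
  by rewrite oddD hk hl.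
rewrite (eq_bigl (mem [set h | edge_at h == a])); last first.
  by move=> h; rewrite !inE andbC; case: eqP => // ->; rewrite aT.
by rewrite sum1_card; case: (edge_at_wf a) => ->.
Qed.

(** A smoothing pairs odd with even ends, so it maps the odd-numbered ends in [H] bijectively onto
    the even-numbered ones. *)
Lemma even_smooth (H : {set crossing * 'I_4}) :
  (forall c i, (c, i) \in H -> (c, smooth (x c) i) \in H) -> ~~ odd #|H|.
Proof.
pose f (h : crossing * 'I_4) := (h.1, smooth (x h.1) h.2).
have fK : involutive f by case=> c i; rewrite /f /= smoothK.
move=> cl; pose O := [set h : crossing * 'I_4 | odd h.2].
have cl' h : h \in H -> f h \in H by case: h => c i /cl.
rewrite -(cardsID O) (_ : H :\: O = f @: (H :&: O)).
  by rewrite card_imset ?addnn ?odd_double //; apply: inv_inj.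
apply/setP => h; apply/idP/imsetP => [|[k]]; rewrite !inE.
  case/andP=> oh hH; exists (f h); rewrite ?fK // !inE.
  by rewrite cl' //= odd_smooth oh.
by case/andP=> kH ok ->; rewrite cl' //= odd_smooth ok.
Qed.

(** Follows the circles of [x] without passing through [c]; such paths survive a change of smoothing
    at [c]. *)
Definition smooth_rel_off c : rel (edge D) := fun a b =>
  [exists c' : crossing, (c' != c) && [exists i : 'I_4,
     (edge_at (c', i) == a) && (edge_at (c', smooth (x c') i) == b)]].

Lemma smooth_off_sub c a b :
  connect (smooth_rel_off c) a b -> connect (smooth_rel x) a b.
Proof.
apply: connect_sub => {}a {}b /existsP[c' /andP[_ h]].
by apply: connect1; apply/existsP; exists c'.
Qed.

(* Otherwise the path leaving c from its end i would be an arc with a single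
   endpoint: i would be the only unpaired end on it. *)
Lemma connect_smooth_off c i :
  circle x (end0 c) != circle x (end2 c) ->
  connect (smooth_rel_off c) (edge_at (c, i)) (edge_at (c, smooth (x c) i)).
Proof.
move=> ne; set e := edge_at (c, i); apply: contraT => nconn.
pose T := [set b | connect (smooth_rel_off c) e b].
pose H := [set h | edge_at h \in T].
(* The partner of [i] is excluded by assumption, the two remaining ends because they lie on the
   other circle at [c]. *)
have Hc j : (c, j) \in H -> j = i.
  rewrite !inE => ej.
  have cej : circle x e = circle x (edge_at (c, j)).
    by apply/eqP; rewrite -mem_circle inE; apply: smooth_off_sub ej.
  case: (eqVneq j (smooth (x c) i)) ej nconn => [-> -> //|nj _ _].
  apply: contraTeq (ne) => ji; have si := on_strand0N ji nj.
  move: cej; rewrite /e [LHS]circle_edge_at [RHS]circle_edge_at si negbK.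
  by case: on_strand0 => /= ->.
have := even_ends T; rewrite -/H (cardsD1 (c, i)) inE inE connect0 /=.
rewrite negbK => oH.
suff : ~~ odd #|H :\ (c, i)| by rewrite oH.
apply: even_smooth => c' j; rewrite in_setD1 => /andP[ne' hH].
have nc : c' != c.
  by apply: contraNneq ne' => ec; rewrite ec (Hc j) // -ec.
rewrite in_setD1 xpair_eqE (negPf nc) /=; move: hH; rewrite !inE => /connect_trans; apply.
apply: connect1; apply/existsP; exists c'; rewrite nc /=.
by apply/existsP; exists j; rewrite !eqxx.
Qed.

Lemma smooth_rel_off_flip c (y : state D) :
  (forall t, t != c -> y t = x t) -> subrel (smooth_rel_off c) (smooth_rel y).
Proof.
move=> yx a b /existsP[c' /andP[nc /existsP[i h]]].
by apply/existsP; exists c'; apply/existsP; exists i; rewrite yx.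
Qed.

End Circles.

(** With [c] removed, each of the two circles of [x] at [c] remains a path between its two ends
    there; the other smoothing closes these paths up to a single circle. *)
Lemma circle_flip (D : link_diagram) (x y : state D) (c : 'I_(ncross D)) :
  (forall t, t != c -> y t = x t) -> y c = ~~ x c ->
  circle x (end0 c) != circle x (end2 c) ->
  circle y (end0 c) = circle y (end2 c) /\
  (forall a b, circle x a = circle x b -> circle y a = circle y b).
Proof.
move=> yx yc ne.
have off a b : connect (smooth_rel_off x c) a b -> circle y a = circle y b.
  move=> ab; apply/eqP; rewrite -mem_circle inE; apply: connect_sub ab => {}a {}b ab.
  exact/connect1/(smooth_rel_off_flip yx).
have ends i : circle y (edge_at (c, i)) = circle y (edge_at (c, smooth (x c) i)).
  exact/off/connect_smooth_off.
split.
  (* From end 0, the smoothing of [y] at [c] and then a path of [x] off [c] lead to end 2. *)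
  have := circle_smooth y c (@Ordinal 4 0 isT); rewrite [LHS]/= yc => ->.
  rewrite ends /end2; congr (circle y (edge_at (c, _))).
  by case: (x c); apply: val_inj.
move=> a b /eqP; rewrite -mem_circle inE => ab.
apply/eqP; rewrite -mem_circle inE; apply: connect_sub ab => {}a {}b.
case/existsP=> c' /existsP[i /andP[/eqP<- /eqP<-]].
suff : circle y (edge_at (c', i)) = circle y (edge_at (c', smooth (x c') i)).
  by move/eqP; rewrite -mem_circle inE.
have [->|nc] := eqVneq c' c; first exact: ends.
by rewrite -yx // -circle_smooth.
Qed.

(** Take for [d] the length of a shortest path from [p]; the last vertex before [q] on such a path
    is the required [u]. *)
Lemma exists_distance (T : finType) (e : rel T) (p : T) : exists d : T -> nat,
  d p = 0 /\ forall q, connect e p q -> q != p -> exists2 u, e u q & d u < d q.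
Proof.
pose P q n := [exists t : n.-tuple T, path e p t && (last p t == q)].
have PP q s : path e p s -> last p s = q -> P q (size s).
  by move=> ps lq; apply/existsP; exists (in_tuple s); rewrite ps lq eqxx.
have exP q : connect e p q -> exists n, P q n.
  by case/connectP=> s ps ->; exists (size s); exact: PP.
(* [ex_minn] takes a proof of existence; unreachable vertices get the default value 0. *)
pose d q := if connect e p q =P true is ReflectT h then ex_minn (exP q h) else 0.
have dP q n : P q n -> d q <= n.
  by rewrite /d; case: eqP => // h Pn; case: ex_minnP => m _; apply.
exists d; split=> [|q pq qp]; first by apply/eqP; rewrite -leqn0; apply: dP (PP p [::] _ _).
rewrite {2}/d; case: eqP => // h; case: ex_minnP => m /existsP[t /andP[pt /eqP lt]] _.
have szt := size_tuple t; case/lastP: {t}(val t) pt lt szt => [|s z].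
  by move=> _ /= pz; rewrite pz eqxx in qp.
rewrite rcons_path last_rcons => /andP[ps ez] zq <-; subst z.
by exists (last p s); rewrite // size_rcons ltnS; apply: dP; apply: PP.
Qed.

(** * Zones, distances and the components of G_x minus a vertex *)

Section Zones.
Variables (D : link_diagram) (x : state D).
Local Notation crossing := 'I_(ncross D).
Local Notation V := {set edge D}.
Implicit Types (u v w q r : V) (s : bool).

Definition arc_adj s : rel V := fun u w =>
  [exists c, [&& x c == s, u \in arc_ends x c & w \in arc_ends x c]].

(** A-zones for [s = true], B-zones for [s = false]; a circle on no arc of type [s] is a class by
    itself. *)
Definition zone s : rel V := connect (arc_adj s).

Lemma arc_adj_sym s : symmetric (arc_adj s).
Proof. by move=> u w; apply: eq_existsb => c; rewrite [(u \in _) && _]andbC. Qed.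

Lemma zone_sym s u w : zone s u w = zone s w u.
Proof. exact/sym_connect_sym/arc_adj_sym. Qed.

Lemma zone_arc s c u w :
  x c = s -> u \in arc_ends x c -> w \in arc_ends x c -> zone s u w.
Proof. by move=> xc uc wc; apply/connect1/existsP; exists c; rewrite xc eqxx uc. Qed.

Lemma circle_in a : circle x a \in circles x.
Proof. by apply/imsetP; exists a. Qed.

Lemma arc_ends_circle c u : u \in arc_ends x c -> u \in circles x.
Proof. by rewrite !inE => /orP[]/eqP->; exact: circle_in. Qed.

(** G_x is connected because the diagram is: edges that meet at a crossing lie on circles incident
    to its arc. So [d] can be the distance in G_x from the circle of [p]. *)
Lemma circles_distance (p : edge D) : exists d : V -> nat, d (circle x p) = 0 /\
  forall q, q \in circles x -> q != circle x p ->
    exists s, exists2 u, arc_adj s u q & d u < d q.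
Proof.
pose e : rel V := fun u w => arc_adj true u w || arc_adj false u w.
have [d [d0 dS]] := exists_distance e (circle x p); exists d; split=> // _ /imsetP[b _ ->] bp.
have [|//|u eu ltu] := dS (circle x b).
  have [_ /(_ p b)/connectP[t pt ->]] := edge_at_connected D.
  elim: t p pt {d d0 dS bp} => [|a t IH] p /=; first by rewrite connect0.
  case/andP=> /existsP[c /existsP[i /existsP[j /andP[/eqP hp /eqP ha]]]] /IH.
  apply: connect_trans; apply: connect1; rewrite /e -hp -ha.
  by case E: (x c); apply/orP; [left|right]; apply/existsP; exists c;
     rewrite E !circle_arc_end.
by case/orP: eu => eu; [exists true|exists false]; exists u.
Qed.

(* An arc of type s leads from q to the component of G_x - q which contains p. *)
Definition side (p : edge D) s q : bool :=
  [exists c, [&& x c == s, q \in arc_ends x c &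
     [exists u in arc_ends x c :\ q, connect (del_adj x q) u (circle x p)]]].

Lemma del_adj_sym q : symmetric (del_adj x q).
Proof.
move=> u w; rewrite /del_adj andbCA; congr [&& _, _ & _].
by apply: eq_existsb => c; rewrite andbC.
Qed.

Lemma side_unique p q : homogeneous x -> side p true q -> ~~ side p false q.
Proof.
move=> hom /existsP[c /and3P[/eqP xc qc /exists_inP[u uc up]]].
apply/negP => /existsP[c' /and3P[/eqP xc' qc' /exists_inP[w wc wp]]].
suff: x c = x c' by rewrite xc xc'.
apply/hom/connect1/exists_inP; exists q; first exact: arc_ends_circle qc.
(* Both arcs lead to the component of [p], so they are attached whether or not [q] is a cut
   vertex. *)
rewrite qc qc'; apply/implyP => _; apply/exists_inP; exists u => //.
apply/exists_inP; exists w => //; apply: connect_trans up _.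
by rewrite (sym_connect_sym (@del_adj_sym q)).
Qed.

Lemma arc_adj_del s q u w : u != q -> w != q -> arc_adj s u w -> del_adj x q u w.
Proof.
move=> uq wq /existsP[c /andP[_ h]].
by rewrite /del_adj uq wq; apply/existsP; exists c.
Qed.

Lemma arc_adj_circle s u w : arc_adj s u w -> w \in circles x.
Proof. by case/existsP=> c /and3P[_ _]; exact: arc_ends_circle. Qed.

(** * The labelling determined by distances to p *)

Section Labels.
Variables (p : edge D) (d : V -> nat).
Hypothesis hom : homogeneous x.
Hypothesis d0 : d (circle x p) = 0.
Hypothesis dS : forall q, q \in circles x -> q != circle x p ->
  exists s, exists2 u, arc_adj s u q & d u < d q.

(** A walk along which [d] decreases starts at most at the level of [q] and is strictly below it
    afterwards, so it never meets [q]. *)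
Lemma descent q r : r \in circles x -> r != q -> d r <= d q ->
  connect (del_adj x q) r (circle x p).
Proof.
elim/ltn_ind: {r}(d r) {-2}r (erefl (d r)) => n IH r dr rV rq le.
have [->|rp] := eqVneq r (circle x p); first exact: connect0.
have [s [u ur ltu]] := dS rV rp; have ltq := leq_trans ltu le.
have uq : u != q by apply: contraTneq ltq => ->; rewrite ltnn.
apply: (@connect_trans _ _ u); first by apply/connect1/(@arc_adj_del s); rewrite // arc_adj_sym.
apply: (IH (d u)) => //; [by rewrite -dr| |exact: ltnW].
by apply: (@arc_adj_circle s r); rewrite arc_adj_sym.
Qed.

(** A simple path from [q] to [r] inside the zone leaves [q] by an arc of type [s] and does not
    return; [descent] continues it to [p], still avoiding [q]. *)
Lemma zone_side s q r : r \in circles x -> r != q -> d r <= d q ->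
  zone s q r -> side p s q.
Proof.
move=> rV rq le /connectP[t0 pt rt]; move: rV rq le; rewrite {}rt.
case/shortenP: pt => -[|u t] /=; first by rewrite eqxx.
case/andP=> /existsP[c /and3P[xc qc uc]] pt /andP[]; rewrite in_cons negb_or.
case/andP=> qu qt _ _ rV rq le; apply/existsP; exists c; rewrite xc qc /=.
apply/exists_inP; exists u; first by rewrite in_setD1 eq_sym qu.
apply: connect_trans (descent rV rq le).
elim: t u {xc uc rV rq le} pt qu qt => [|w t IH] u /=; first by rewrite connect0.
case/andP=> uw pt qu; rewrite in_cons negb_or => /andP[qw qt].
by apply: connect_trans (IH w pt qw qt); apply/connect1/(@arc_adj_del s); rewrite // eq_sym.
Qed.

(** Label 1 and type A are both [true]: away from [p], the label is itself the type of the zone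
    leading towards [p]. *)
Definition zone_label (b : bool) q : bool :=
  if q == circle x p then b else [exists r in circles x, zone true q r && (d r < d q)].

Lemma zone_labelP b q : q \in circles x -> q != circle x p ->
  exists r, [/\ r \in circles x, zone (zone_label b q) q r & d r < d q].
Proof.
move=> qV qp; rewrite /zone_label (negPf qp).
case: exists_inP => [[r rV /andP[]]|noA]; first by exists r.
have [s [u uq ltu]] := dS qV qp; have qu : arc_adj s q u by rewrite arc_adj_sym.
exists u; split=> //; first exact: arc_adj_circle qu.
case: s {uq} qu => qu; last exact: connect1.
by case: noA; exists u; [exact: arc_adj_circle qu|rewrite ltu andbT; exact: connect1].
Qed.

(** Both [r] and the closer circle from [zone_labelP] show a side of [q] that leads to [p], and
    [side_unique] identifies the two types. The inequality is weak, so that ties in distance are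
    covered. *)
Lemma label_far b s q r : q \in circles x -> r \in circles x -> r != q ->
  q != circle x p -> d r <= d q -> zone s q r -> zone_label b q = s.
Proof.
move=> qV rV rq qp le /(zone_side rV rq le) sq.
have [r' [r'V zq lt]] := zone_labelP b qV qp.
have r'q : r' != q by apply: contraTneq lt => ->; rewrite ltnn.
have := zone_side r'V r'q (ltnW lt) zq; move: sq.
have no := @side_unique p q hom.
by case: s (zone_label b q) => -[] // s1 s2; move: no; rewrite s1 s2 => /(_ isT).
Qed.

Lemma d_gt0 q : q \in circles x -> q != circle x p -> 0 < d q.
Proof. by move=> qV qp; have [s [u _]] := dS qV qp; exact: leq_ltn_trans. Qed.

(** Of two distinct circles, the one not closer to [p] would have label [s] by [label_far]. *)
Lemma zone_label_unique b s u w : u \in circles x -> w \in circles x -> zone s u w ->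
  zone_label b u = ~~ s -> zone_label b w = ~~ s -> u = w.
Proof.
wlog le : u w / d u <= d w => [W|] uV wV z lu lw.
  have [/W|/ltnW/W W'] := leqP (d u) (d w); first exact.
  by apply/esym/W' => //; rewrite zone_sym.
apply/eqP; apply: contraT => uw.
(* If [w] were the circle of [p], then [u] would be at distance 0 and hence equal to [w]. *)
have wp : w != circle x p.
  apply: contraNneq uw => wp; move: le; rewrite wp d0 leqn0; apply: contraTT => up.
  by rewrite -lt0n d_gt0.
rewrite zone_sym in z; have := label_far b wV uV uw wp le z.
by rewrite lw; case: s {z lu lw}.
Qed.

(** Meant for the labels [l] of an enhancement reached both by A-moves and by B-moves. By induction
    on the distance: a disagreement at [a] produces another circle of the same zone with the
    exceptional label [~~ s]. *)
Lemma zone_label_determined b (l : edge D -> bool) :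
  (forall s a a', zone s (circle x a) (circle x a') ->
     l a = ~~ s -> l a' = ~~ s -> circle x a = circle x a') ->
  (forall s a, l a = ~~ s -> exists2 a', zone s (circle x a) (circle x a') &
     zone_label b (circle x a') = ~~ s) ->
  forall a, l a = zone_label b (circle x a).
Proof.
move=> uniq ex a; move: {2}(d _) (erefl (d (circle x a))) => n; elim/ltn_ind: n a => n IH a da.
set s := zone_label b (circle x a); apply/eqP; apply: contraT => las.
have {}las : l a = ~~ s by move: las; case: (l a) s => -[].
have [a' z la'] := ex s a las.
have ne : circle x a != circle x a'.
  by apply: contraTneq isT => E; move: la'; rewrite -E -/s; case: s {las z}.
(* If [a'] is closer, induction gives [l] two labels [~~ s] in one zone; otherwise [label_far] at
   [a'] forces the label [s] there. *)
have [lt|le] := ltnP (d (circle x a')) (d (circle x a)).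
  have la2 : l a' = ~~ s by rewrite -la'; apply: (IH (d (circle x a'))); rewrite -?da.
  by rewrite (uniq _ _ _ z las la2) eqxx in ne.
have a'p : circle x a' != circle x p.
  apply: contraNneq ne => E; move: le; rewrite E d0 leqn0; apply: contraTT => up.
  by rewrite -lt0n d_gt0 // circle_in.
rewrite zone_sym in z; have := label_far b (circle_in a') (circle_in a) ne a'p le z.
by rewrite la'; case: s {las z la'}.
Qed.

End Labels.
End Zones.

(** * Exchanges of labels along crossing arcs *)

Lemma connect_inv (T : finType) (e : rel T) (P : T -> Prop) :
  (forall y z, P y -> e y z -> P z) -> forall y z, P y -> connect e y z -> P z.
Proof.
move=> step y z Py /connectP[s es ->]; elim: s y es Py => //= a s IH y /andP[ya es] Py.
exact: IH es (step _ _ Py ya).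
Qed.

Lemma oppr_F2 (a : 'F_2) : (- a = a)%R.
Proof. exact/oppr_pchar2/pchar_Fp. Qed.

Section Swap.
Variable D : link_diagram.
Local Notation crossing := 'I_(ncross D).
Implicit Types (X Y Z W : enhanced D) (c : crossing).

Lemma label_circle X a b :
  circle (state_of X) a = circle (state_of X) b -> label X a = label X b.
Proof. by move=> E; have /forallP/(_ a)/forallP/(_ b) := valP X; rewrite E eqxx => /eqP. Qed.

Lemma enhanced_ext X Y : state_of X = state_of Y -> label X =1 label Y -> X = Y.
Proof.
rewrite /state_of /label => eqS eqL; apply: val_inj.
by case: (val X) (val Y) eqS eqL => [s l] [s' l'] /= -> /ffunP ->.
Qed.

(** An exchange of labels is precomposition with this map of edges, which has to be an involution
    only up to state circles. *)
Definition swap_edge (x : state D) c a : edge D :=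
  if a \in circle x (end0 c) then end2 c
  else if a \in circle x (end2 c) then end0 c else a.

Lemma circle_swap_edge x c a b :
  circle x a = circle x b -> circle x (swap_edge x c a) = circle x (swap_edge x c b).
Proof. by move=> E; rewrite /swap_edge !mem_circle E; case: ifP => // _; case: ifP. Qed.

Lemma swap_edgeK x c a : circle x (end0 c) != circle x (end2 c) ->
  circle x (swap_edge x c (swap_edge x c a)) = circle x a.
Proof.
move=> /negPf ne; rewrite {2}/swap_edge !mem_circle.
case: eqP => [<-|n0]; first by rewrite /swap_edge !mem_circle ne eqxx.
case: eqP => [<-|n2]; first by rewrite /swap_edge !mem_circle eqxx.
by rewrite /swap_edge !mem_circle (introF eqP n0) (introF eqP n2).
Qed.

Lemma swap_edge0 x c : swap_edge x c (end0 c) = end2 c.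
Proof. by rewrite /swap_edge mem_circle eqxx. Qed.

Lemma swap_edge2 x c : circle x (end0 c) != circle x (end2 c) ->
  swap_edge x c (end2 c) = end0 c.
Proof. by move=> /negPf ne; rewrite /swap_edge !mem_circle ne eqxx. Qed.

Lemma swap_subproof c X :
  labelling_of (state_of X, [ffun a => label X (swap_edge (state_of X) c a)]).
Proof.
apply/forallP => a; apply/forallP => b; apply/implyP => /= /eqP E; rewrite !ffunE.
exact/eqP/label_circle/circle_swap_edge.
Qed.

Definition swap c X : enhanced D := Sub (_, _) (swap_subproof c X).

Lemma state_swap c X : state_of (swap c X) = state_of X.
Proof. by rewrite /state_of SubK. Qed.

Lemma label_swap c X a : label (swap c X) a = label X (swap_edge (state_of X) c a).
Proof. by rewrite /label SubK /= ffunE. Qed.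

Definition ends_differ c X := label X (end0 c) != label X (end2 c).

Lemma A_moveP X Y :
  reflect (exists c, [/\ state_of X c, ends_differ c X & Y = swap c X]) (A_move X Y).
Proof.
have labE c a : (if a \in circle (state_of X) (end0 c) then label X (end2 c)
     else if a \in circle (state_of X) (end2 c) then label X (end0 c)
     else label X a) = label (swap c X) a.
  by rewrite label_swap /swap_edge; case: ifP => // _; case: ifP.
apply: (iffP andP) => [[/eqP sY /existsP[c /and3P[xc df /forallP lY]]]|[c [xc df ->]]].
  exists c; split=> //; apply: enhanced_ext => [|a]; first by rewrite state_swap.
  by rewrite (eqP (lY a)) labE.
split; first by rewrite state_swap.
by apply/existsP; exists c; apply/and3P; split=> //; apply/forallP => a; rewrite labE.
Qed.

Definition B_move X Y : bool :=
  [exists c, [&& ~~ state_of X c, ends_differ c X & Y == swap c X]].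

(** * Exchanges and the differential at an adequate state *)

Section State.
Variable x : state D.
Hypothesis adq : adequate x.

Lemma adequate_neq c : circle x (end0 c) != circle x (end2 c).
Proof. exact/eqP. Qed.

Lemma swapK c X : state_of X = x -> swap c (swap c X) = X.
Proof.
move=> sX; apply: enhanced_ext => [|a]; first by rewrite !state_swap.
rewrite !label_swap state_swap sX; apply: label_circle; rewrite sX.
exact/swap_edgeK/adequate_neq.
Qed.

Lemma label_swap_ends c X : state_of X = x ->
  (label (swap c X) (end0 c) = label X (end2 c)) * (label (swap c X) (end2 c) = label X (end0 c)).
Proof. by move=> sX; rewrite !label_swap sX swap_edge0 swap_edge2 //; exact: adequate_neq. Qed.

Lemma ends_differ_swap c X : state_of X = x -> ends_differ c (swap c X) = ends_differ c X.
Proof. by move=> sX; rewrite /ends_differ !label_swap_ends // eq_sym. Qed.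

Lemma label_swap_off c X a : state_of X = x ->
  a \notin circle x (end0 c) -> a \notin circle x (end2 c) -> label (swap c X) a = label X a.
Proof. by move=> sX /negPf a0 /negPf a2; rewrite label_swap sX /swap_edge a0 a2. Qed.

Lemma zone_swap_edge c a : zone x (x c) (circle x a) (circle x (swap_edge x c a)).
Proof.
have e0 : circle x (end0 c) \in arc_ends x c by rewrite !inE eqxx.
have e2 : circle x (end2 c) \in arc_ends x c by rewrite !inE eqxx orbT.
rewrite /swap_edge !mem_circle; case: eqP => [<-|_]; first exact: zone_arc e0 e2.
case: eqP => [<-|_]; first exact: zone_arc e2 e0.
exact: connect0.
Qed.

(* An A-zone (s = true) has at most one label 0, a B-zone at most one label 1. *)
Definition zone_le1 s Y := forall a a', zone x s (circle x a) (circle x a') ->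
  label Y a = ~~ s -> label Y a' = ~~ s -> circle x a = circle x a'.

(** This survives exchanges along arcs of type [s] and supplies the existence hypothesis of
    [zone_label_determined]. *)
Definition zone_from s X Y := forall a, label Y a = ~~ s ->
  exists2 a', zone x s (circle x a) (circle x a') & label X a' = ~~ s.

Definition zone_class s X Y := [/\ state_of Y = x, zone_le1 s Y & zone_from s X Y].

(** An exchange along [c] moves labels only inside a zone of type [s]. *)
Lemma zone_class_swap s X Y c : x c = s -> zone_class s X Y -> zone_class s X (swap c Y).
Proof.
move=> xc [sY le fr]; split; first by rewrite state_swap.
  move=> a a' z; rewrite !label_swap sY => la la'.
  rewrite -(swap_edgeK a (adequate_neq c)) -(swap_edgeK a' (adequate_neq c)).
  apply/circle_swap_edge/le => //; apply: connect_trans (connect_trans _ z) _.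
    by rewrite -/(zone _ _ _ _) zone_sym -xc; exact: zone_swap_edge.
  by rewrite -xc; exact: zone_swap_edge.
move=> a; rewrite label_swap sY => /fr[a' z la']; exists a' => //.
by apply: connect_trans z; rewrite -xc; exact: zone_swap_edge.
Qed.

Lemma zone_class_refl s X : state_of X = x -> zone_le1 s X -> zone_class s X X.
Proof. by move=> sX le; split=> // a la; exists a => //; exact: connect0. Qed.

Lemma zone_class_A X Y : state_of X = x -> zone_le1 true X -> A_equiv X Y ->
  zone_class true X Y.
Proof.
move=> sX le; apply: connect_inv (zone_class_refl sX le) => {}Y Z cl.
by case/A_moveP => c [yc _ ->]; case: (cl) => sY _ _; apply: zone_class_swap; rewrite -?sY.
Qed.

Lemma zone_class_B X Y : state_of X = x -> zone_le1 false X -> connect B_move X Y ->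
  zone_class false X Y.
Proof.
move=> sX le; apply: connect_inv (zone_class_refl sX le) => {}Y Z cl.
case/existsP => c /and3P[yc _ /eqP->]; case: (cl) => sY _ _.
by apply: zone_class_swap; rewrite -?sY //; exact: negPf.
Qed.

Lemma A_equiv_swap X Y c : state_of Y = x -> x c -> ends_differ c Y ->
  A_equiv X (swap c Y) = A_equiv X Y.
Proof.
move=> sY xc df; apply/idP/idP => h; apply: connect_trans h _; apply/connect1/A_moveP; exists c.
  by rewrite state_swap sY ends_differ_swap // swapK.
by rewrite sY.
Qed.

Lemma B_equiv_swap X Y c : state_of Y = x -> ~~ x c -> ends_differ c Y ->
  connect B_move X (swap c Y) = connect B_move X Y.
Proof.
move=> sY xc df; apply/idP/idP => h; apply: connect_trans h _; apply/connect1/existsP; exists c.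
  by rewrite state_swap sY ends_differ_swap // swapK // xc df eqxx.
by rewrite sY xc df eqxx.
Qed.

(** By adequacy [c] merges two circles, and the merging rule is symmetric in their labels. *)
Lemma d_term_swap_source c X Y :
  state_of X = x -> d_term c (swap c X) Y = d_term c X Y.
Proof.
move=> sX; rewrite /d_term state_swap sX adequate_neq !label_swap_ends //.
congr [&& _, _, _ & _]; last by rewrite /= [label X (end2 c) && _]andbC [label X (end2 c) || _]orbC.
apply: eq_forallb => a; rewrite inE; case: (boolP (_ || _)) => //=.
by rewrite negb_or => /andP[a0 a2]; rewrite label_swap_off.
Qed.

(** As [x] is adequate, passing back from B to A at [c] merges two circles of [x] ([circle_flip]);
    seen from [W], this is a splitting. *)
Lemma d_term_target c W Y : state_of Y = x -> d_term c W Y ->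
  [/\ x c = false, circle (state_of W) (end0 c) = circle (state_of W) (end2 c) &
      forall a b, circle x a = circle x b -> circle (state_of W) a = circle (state_of W) b].
Proof.
rewrite /d_term => sY /and4P[Wc /eqP xW _ _].
have {xW} xW t : x t = if t == c then false else state_of W t by rewrite -sY xW ffunE.
have xc : x c = false by rewrite xW eqxx.
have [|||c02 sub] // := @circle_flip _ x (state_of W) c; rewrite ?xc //.
  by move=> t /negPf tc; rewrite xW tc.
exact: adequate_neq.
Qed.

(** The splitting rule is symmetric in the two new circles. *)
Lemma d_term_swap_target c W Y : state_of Y = x -> ends_differ c Y ->
  d_term c W Y -> d_term c W (swap c Y).
Proof.
move=> sY df h; have [xc c02 sub] := d_term_target sY h; move: h.
rewrite /d_term state_swap c02 eqxx /=. move=> /and4P[-> -> out]; rewrite !label_swap_ends //.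
(* Different labels exclude the rule 1 -> (1,1). *)
move: df; rewrite /ends_differ => df; case: ifP => [_|_ _]; first by case/andP=> l0 l2; rewrite l0 l2 in df.
rewrite eq_sym df andbT /=; apply/forallP => a; apply/implyP => ha.
move/forallP/(_ a)/implyP/(_ ha): out => /eqP <-; apply/eqP.
move: ha; rewrite setUid mem_circle => ha.
apply: label_swap_off => //; rewrite mem_circle; apply: contraNneq ha => /sub.
  by rewrite c02 => ->.
by move=> ->.
Qed.

(** For fixed [c] and [Y] the terms of [X] and [swap c X] cancel: the sign given by [nA_before]
    depends only on the state, and [u] changes sign. *)
Lemma cycle_of_antisym (R : pzRingType) (u : chain D R) :
  (forall X, u X != 0%R -> state_of X = x /\ zone_le1 true X) ->
  (forall c X, state_of X = x -> x c -> ends_differ c X -> u (swap c X) = - u X)%R ->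
  cycle_chain u.
Proof.
move=> supp anti; apply/ffunP => Y; rewrite !ffunE exchange_big big1 //= => c _.
pose P X := [&& state_of X == x, x c & ends_differ c X].
(* Equal labels at [c] contribute nothing: (1,1) merges to zero, and (0,0) would be two labels 0 in
   one A-zone. *)
rewrite (bigID P) /= [X in (_ + X)%R]big1 => [|X nP]; last first.
  have [->|/supp[sX le]] := eqVneq (u X) 0%R; first by rewrite mul0r.
  case: (boolP (d_term c X Y)) => [|_]; last by rewrite !mulr0.
  move: nP; rewrite /d_term /P sX eqxx /= => nP /and4P[xc _ _].
  move: nP; rewrite xc adequate_neq /ends_differ negbK => /eqP eqL /andP[].
  rewrite eqL andbb => /negPf l2 _; case/eqP: (adequate_neq c); apply: le; rewrite ?eqL //.
  by apply: (@zone_arc _ _ _ c); rewrite ?xc // !inE eqxx ?orbT.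
rewrite addr0; apply: (@sum_antisym _ _ _ (fun X => label X (end0 c)) (swap c)).
- by move=> X /and3P[/eqP sX xc df]; rewrite /P state_swap ends_differ_swap // sX eqxx xc.
- by move=> X /and3P[/eqP sX _ _]; exact: swapK.
- move=> X /and3P[/eqP sX _]; rewrite label_swap_ends // /ends_differ.
  by case: (label X _) (label X _) => -[].
- move=> X /and3P[/eqP sX xc df]; rewrite anti // d_term_swap_source // mulNr.
  by rewrite /nA_before state_swap.
Qed.

(** For fixed [W] and [c], the outcomes (1,0) and (0,1) of a splitting lie in the same class under
    B-moves and have equal coefficients, so they cancel over F_2. *)
Lemma sum_B_exact X (v : chain D 'F_2) : state_of X = x -> zone_le1 false X ->
  (\sum_(Y | connect B_move X Y) diff v Y = 0)%R.
Proof.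
move=> sX le; under eq_bigr do rewrite ffunE.
rewrite exchange_big big1 //= => W _; rewrite exchange_big big1 //= => c _.
rewrite -!mulr_sumr.
pose P Y := d_term c W Y && ends_differ c Y.
(* Equal labels after a splitting can only be (1,1), which would be two labels 1 in one B-zone. *)
rewrite (bigID P) /= [X in (_ + X)%R]big1 => [|Y /andP[/(zone_class_B sX le)[sY leY _]]]; last first.
  rewrite negb_and; case: (boolP (d_term c W Y)) => //= h /negPn/eqP eqL.
  have [xc c02 _] := d_term_target sY h; case/eqP: (adequate_neq c).
  have lY : label Y (end0 c).
    move: h; rewrite /d_term c02 eqxx /= => /and4P[_ _ _].
    by rewrite eqL; case: ifP => [_ /andP[]|_]; rewrite ?eqxx.
  apply: leY; rewrite -?eqL //; apply: (@zone_arc _ _ _ c); rewrite ?xc // !inE eqxx ?orbT //.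
rewrite addr0 (_ : (\sum_(Y | _) _)%R = 0%R) ?mulr0 //.
apply: (@sum_antisym _ _ _ (fun X => label X (end0 c)) (swap c)).
- move=> Y /andP[XY /andP[h df]]; have [sY _ _] := zone_class_B sX le XY.
  have [xc _ _] := d_term_target sY h.
  by rewrite B_equiv_swap ?xc // XY /P d_term_swap_target // ends_differ_swap.
- by move=> Y /andP[/(zone_class_B sX le)[sY _ _] _]; exact: swapK.
- move=> Y /andP[/(zone_class_B sX le)[sY _ _] /andP[_]]; rewrite label_swap_ends // /ends_differ.
  by case: (label Y _) (label Y _) => -[].
move=> Y /andP[/(zone_class_B sX le)[sY _ _] /andP[h df]].
by rewrite h d_term_swap_target // oppr_F2.
Qed.
End State.
End Swap.

(** * Traces: cycles, signs and non-exactness *)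

Section Traces.
Variables (D : link_diagram) (x : state D).
Hypothesis adq : adequate x.
Local Notation crossing := 'I_(ncross D).
Implicit Types (X Y : enhanced D) (c : crossing).

Lemma trF2E X Y : trF2 X Y = (A_equiv X Y)%:R%R.
Proof.
rewrite /trF2 sum_ffunE; under eq_bigr do rewrite ffunE.
rewrite big_mkcond (bigD1 Y) //= eqxx big1 ?addr0 => [|Z]; first by case: ifP.
by rewrite eq_sym => /negPf->; rewrite if_same.
Qed.

Lemma trZE X Y : trZ X Y = ((A_equiv X Y)%:R * sgn X Y)%R.
Proof.
rewrite /trZ sum_ffunE.
have scaleE Z : (gen int Z *~ sgn X Z)%R Y = ((Y == Z)%:R * sgn X Z)%R.
  by rewrite /sgn; case: ifP => _; rewrite ?mulr1z ?mulrN1z !ffunE ?mulr1 ?mulrN1.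
under eq_bigr do rewrite scaleE.
rewrite big_mkcond (bigD1 Y) //= eqxx big1 ?addr0 => [|Z].
  by case: ifP; rewrite ?mul1r ?mul0r.
by rewrite eq_sym => /negPf->; rewrite mul0r if_same.
Qed.

Lemma trF2_cycle X : state_of X = x -> zone_le1 x true X -> cycle_chain (trF2 X).
Proof.
move=> sX le; apply: (cycle_of_antisym adq) => [Y|c Y sY xc df].
  rewrite trF2E; case: (boolP (A_equiv X Y)) => [XY _|_]; last by rewrite eqxx.
  by have [] := zone_class_A adq sX le XY.
by rewrite !trF2E (A_equiv_swap adq) // oppr_F2.
Qed.

Section Sign.
Variable f : {set edge D} -> bool.
Hypothesis f2 : forall c, x c -> f (circle x (end0 c)) != f (circle x (end2 c)).

(** The parity of the number of these circles keeps track of the parity of the number of A-moves. *)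
Definition ones Y : {set {set edge D}} :=
  [set circle x a | a in [set a | f (circle x a) && label Y a]].

Lemma mem_ones Y a : state_of Y = x ->
  (circle x a \in ones Y) = f (circle x a) && label Y a.
Proof.
move=> sY; apply/imsetP/idP => [[b]|h]; last by exists a; rewrite ?inE.
by rewrite inE => h E; rewrite E (@label_circle _ _ a b) // sY.
Qed.

(** Exactly one of the two circles at [c] has colour [true], and exchanging different labels toggles
    the membership of this circle only. *)
Lemma odd_ones_swap Y c : state_of Y = x -> x c -> ends_differ c Y ->
  odd #|ones (swap c Y)| = ~~ odd #|ones Y|.
Proof.
move=> sY xc df; have sZ : state_of (swap c Y) = x by rewrite state_swap.
pose e := if f (circle x (end0 c)) then end0 c else end2 c.
have fe : f (circle x e) by rewrite /e; case: ifPn (f2 xc) => // _; case: (f _).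
have toggle : (circle x e \in ones (swap c Y)) = ~~ (circle x e \in ones Y).
  rewrite !mem_ones // fe /= /e; case: ifP => _; rewrite (label_swap_ends adq) //;
  by move: df; rewrite /ends_differ; case: (label Y _) (label Y _) => -[].
suff same : ones (swap c Y) :\ circle x e = ones Y :\ circle x e.
  rewrite (cardsD1 (circle x e)) [in RHS](cardsD1 (circle x e)) same toggle !oddD.
  by case: (_ \in _); rewrite ?addbN ?addNb ?negbK.
apply/setP => C; rewrite !in_setD1; case: eqP => //= /eqP Ce.
have aux Z : C \in ones Z -> exists2 a, C = circle x a & f (circle x a).
  by case/imsetP => a; rewrite inE => /andP[fa _] ->; exists a.
have key a : C = circle x a -> f (circle x a) -> (C \in ones (swap c Y)) = (C \in ones Y).
  move=> Ca fa; rewrite Ca in Ce *; rewrite !mem_ones // fa /=; apply: (label_swap_off sY).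
    by rewrite mem_circle; apply: contraNneq Ce => E; rewrite /e E fa E.
  rewrite mem_circle; apply: contraNneq Ce => E; rewrite /e.
  by have := f2 xc; rewrite E fa => /negPf; case: (f _) => // _; rewrite E.
apply/idP/idP => h; have [a Ca fa] := aux _ h; first by rewrite -(key a).
by rewrite (key a).
Qed.

(** Each move changes the parity of [ones], so only one parity of moves can lead from [X] to [Y]. *)
Lemma sgnE X Y : state_of X = x -> A_equiv X Y ->
  (sgn X Y = (-1) ^+ addb (odd #|ones X|) (odd #|ones Y|))%R.
Proof.
move=> sX XY.
pose I (Yb : enhanced D * bool) := state_of Yb.1 = x /\ Yb.2 = odd #|ones X| (+) odd #|ones Yb.1|.
have inv : forall Yb, connect (@A_move_parity D) (X, false) Yb -> I Yb.
  move=> Yb; apply: (@connect_inv _ _ I) => [[Z b] [Z' b'] [/= sZ bE]|].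
    case/andP => /A_moveP[c /= [Zc df ->]] /eqP ->; rewrite sZ in Zc.
    by split; rewrite /= ?state_swap // odd_ones_swap // bE addbN.
  by split; rewrite //= addbb.
(* The moves from [X] to [Y] lift to pairs that record the parity. *)
have [b XYb] : exists b, connect (@A_move_parity D) (X, false) (Y, b).
  pose J Z := exists b, connect (@A_move_parity D) (X, false) (Z, b).
  apply: (@connect_inv _ _ J _ X Y) XY; last by exists false.
  move=> Z Z' [b XZ] ZZ'; exists (~~ b); apply: connect_trans XZ _.
  by apply: connect1; rewrite /A_move_parity /= ZZ' eqxx.
have [_ /= bE] := inv _ XYb; rewrite -bE /sgn.
case: ifP => [/inv[_ /= ]|nXY]; first by rewrite -bE => <-.
by case: b XYb {bE} => // XYf; rewrite XYf in nXY.
Qed.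

Lemma trZ_cycle_colouring X : state_of X = x -> zone_le1 x true X -> cycle_chain (trZ X).
Proof.
move=> sX le; apply: (cycle_of_antisym adq) => [Y|c Y sY xc df].
  rewrite trZE; case: (boolP (A_equiv X Y)) => [XY _|_]; last by rewrite mul0r eqxx.
  by have [] := zone_class_A adq sX le XY.
rewrite !trZE (A_equiv_swap adq) //; case: (boolP (A_equiv X Y)) => [XY|_]; last by rewrite !mul0r oppr0.
rewrite !sgnE ?(A_equiv_swap adq) // odd_ones_swap // addbN !mul1r.
by case: (_ (+) _); rewrite ?opprK.
Qed.
End Sign.

Lemma trZ_cycle X : GxA_bipartite x -> state_of X = x -> zone_le1 x true X ->
  cycle_chain (trZ X).
Proof. by case=> f f2; exact: trZ_cycle_colouring f2 X. Qed.

(** Reduction modulo 2 commutes with the differential and turns every sign into 1. *)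
Lemma trZ_exact X : exact_chain (trZ X) -> exact_chain (trF2 X).
Proof.
case=> v tE; exists [ffun Y => (v Y)%:~R%R]; apply/ffunP => Y; rewrite ffunE trF2E.
have sgn2 : ((sgn X Y)%:~R = 1 :> 'F_2)%R by rewrite /sgn; case: ifP => _; apply/eqP.
have := congr1 (fun u : chain D int => (u Y)%:~R%R : 'F_2) tE.
rewrite trZE rmorphM /= sgn2 mulr1 ffunE rmorph_sum /= => tE'.
transitivity ((A_equiv X Y)%:R%:~R : 'F_2)%R; first by case: A_equiv.
rewrite tE'; apply: eq_bigr => Z _; rewrite rmorph_sum; apply: eq_bigr => t _.
by rewrite ffunE !rmorphM /= rmorphXn /= rmorphN1 rmorph_nat.
Qed.

(** The functional of [sum_B_exact] takes the value 1 on the trace, as only the term [Y = X]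
    contributes. *)
Lemma trF2_not_exact X : state_of X = x -> zone_le1 x false X ->
  (forall Y, A_equiv X Y -> connect (@B_move D) X Y -> Y = X) -> ~ exact_chain (trF2 X).
Proof.
move=> sX le uniq [v vE]; have := sum_B_exact adq v sX le; rewrite -vE.
under eq_bigr do rewrite trF2E.
rewrite (bigD1 X) ?connect0 //= big1 => [|Y /andP[XY YX]]; first by rewrite /A_equiv connect0.
by case: (boolP (A_equiv X Y)) => // AXY; rewrite (uniq Y) ?eqxx in YX.
Qed.

End Traces.

(** * The enhancement rooted at p *)

Section RootedEnhancement.
Variables (D : link_diagram) (x : state D) (p : edge D) (d : {set edge D} -> nat) (b : bool).
Hypothesis hx : homogeneously_adequate x.
Hypothesis d0 : d (circle x p) = 0.
Hypothesis dS : forall q, q \in circles x -> q != circle x p ->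
  exists s, exists2 u, arc_adj x s u q & d u < d q.

Let adq : adequate x := hx.2.
Let lab := zone_label x p d b.

Lemma rooted_subproof : labelling_of (x, [ffun a => lab (circle x a)]).
Proof.
by apply/forallP => a; apply/forallP => a'; apply/implyP => /= /eqP E; rewrite !ffunE E.
Qed.

Definition rooted : enhanced D := Sub (_, _) rooted_subproof.

Lemma state_rooted : state_of rooted = x.
Proof. by rewrite /state_of SubK. Qed.

Lemma label_rooted a : label rooted a = lab (circle x a).
Proof. by rewrite /label SubK ffunE. Qed.

Lemma rooted_le1 s : zone_le1 x s rooted.
Proof.
move=> a a' z; rewrite !label_rooted; apply: (zone_label_unique hx.1 d0 dS) z; exact: circle_in.
Qed.

(** The invariants of A-moves and of B-moves are the hypotheses of [zone_label_determined] for the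
    two types [s]. *)
Lemma rooted_unique Y : A_equiv rooted Y -> connect (@B_move D) rooted Y -> Y = rooted.
Proof.
move=> /(zone_class_A adq state_rooted (rooted_le1 (s := true)))[sY leA frA].
move=> /(zone_class_B adq state_rooted (rooted_le1 (s := false)))[_ leB frB].
apply: enhanced_ext => [|a]; first by rewrite sY state_rooted.
rewrite label_rooted; apply: (zone_label_determined hx.1 d0 dS) => [[]|[]] //.
  by move=> a1 /frA[a2 z]; rewrite label_rooted; exists a2.
by move=> a1 /frB[a2 z]; rewrite label_rooted; exists a2.
Qed.

Lemma rooted_trF2 : nonzero_class (trF2 rooted).
Proof.
split; first exact: (trF2_cycle adq state_rooted (rooted_le1 (s := true))).
exact: (trF2_not_exact adq state_rooted (rooted_le1 (s := false)) rooted_unique).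
Qed.

Lemma rooted_trZ : GxA_bipartite x -> nonzero_class (trZ rooted).
Proof.
move=> bip; split; first exact: (trZ_cycle adq bip state_rooted (rooted_le1 (s := true))).
by move/trZ_exact; exact: rooted_trF2.2.
Qed.
End RootedEnhancement.

Theorem mainTheorem2 (D : link_diagram) (x : state D)
    (hx : homogeneously_adequate x) (p : edge D) :
  exists Xm Xp : enhanced D,
    state_of Xm = x /\ state_of Xp = x /\
    label Xm p = true /\ label Xp p = false /\
    (forall a : edge D, circle x a <> circle x p -> label Xm a = label Xp a) /\
    nonzero_class (trF2 Xp) /\ nonzero_class (trF2 Xm) /\
    (GxA_bipartite x ->
       nonzero_class (trZ Xp) /\ nonzero_class (trZ Xm)).
Proof.
have [d [d0 dS]] := circles_distance x p.
(* Both use the same [d], and [b] enters [zone_label] only at the circle of [p], so they agree on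
   all other circles. *)
exists (rooted x p d true), (rooted x p d false); rewrite !state_rooted.
do 2!split=> //; rewrite !label_rooted /zone_label eqxx; do 2!split=> //.
split; first by move=> a /eqP/negPf ap; rewrite !label_rooted /zone_label ap.
split; first exact: rooted_trF2.
split; first exact: rooted_trF2.
by split; exact: rooted_trZ.
Qed.
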